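(* Let $G$ be a finitely generated non-trivial group, let $X$ be a finite generating set of $G$, and let $d$ be a positive integer. Suppose that $G$ contains dead end elements of depth $d$ with respect to $X$. Let $\mathbb{Z}$ be generated by $t$. Then $G\wr\mathbb{Z}$ contains dead end elements of depth $d$ with respect to the generating set $X\cup\{t\}$.
   Context: The wreath product $G\wr\mathbb{Z}$ is the semidirect product $\left(\bigoplus_{i\in\mathbb{Z}}G\right)\rtimes\mathbb{Z}$, where the generator $t$ of $\mathbb{Z}$ acts by shifting the index; $G$ (and hence $X$) is identified with the copy of $G$ indexed by $0\in\mathbb{Z}$, and $t^iGt^{-i}$ is the copy of $G$ indexed by $i$. For a group $H$ with finite generating set $S$, $|w|$ denotes the word length of $w\in H$ with respect to $S$. An element $w\in H$ with $|w|=N$ is a dead end element (or dead end word) with respect to $S$ if $|wx|\le N$ for all $x\in S\cup S^{-1}$. A dead end element $w$ with $|w|=N$ has depth $k$ with respect to $S$ if $k$ is the largest integer such that $|wx_1x_2\cdots x_l|\le N$ for all $1\le l\le k$ and all choices of $x_1,\dots,x_l\in S\cup S^{-1}$. *)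

(* Defs.v *)
From HB Require Import structures.
From mathcomp Require Import all_boot all_order all_algebra.
From mathcomp Require Import finmap boolp.

Set Implicit Arguments.
Unset Strict Implicit.
Unset Printing Implicit Defensive.

Local Open Scope group_scope.
Local Open Scope fset_scope.

Section WordLength.
Variable H : groupType.
Implicit Types (S : {fset H}) (w : H) (s : seq H).

Definition letters S : {fset H} := S `|` [fset x^-1 | x in S].

Definition is_word_for S w n : Prop :=
  exists s, [/\ {subset s <= letters S}, size s = n & \prod_(x <- s) x = w].

Definition generates S : Prop := forall w, exists n, is_word_for S w n.

Lemma wlen_subproof S (genS : generates S) w : exists n, `[< is_word_for S w n >].
Proof. by have [n wn] := genS w; exists n; apply/asboolP. Qed.

Definition wlen S (genS : generates S) w : nat :=
  ex_minn (wlen_subproof genS w).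

Definition dead_end S (genS : generates S) w : Prop :=
  forall x, x \in letters S -> (wlen genS (w * x) <= wlen genS w)%N.

Definition stays_within S (genS : generates S) w k : Prop :=
  forall s, {subset s <= letters S} -> (1 <= size s <= k)%N ->
    (wlen genS (w * \prod_(x <- s) x) <= wlen genS w)%N.

(* When every k qualifies (as for a longest element of a finite group), there
   is no largest one and no depth is assigned. *)
Definition dead_end_of_depth S (genS : generates S) w d : Prop :=
  [/\ dead_end genS w, stays_within genS w d
    & forall k, stays_within genS w k -> (k <= d)%N].

Lemma is_wordM S v w m n :
  is_word_for S v m -> is_word_for S w n -> is_word_for S (v * w) (m + n).
Proof.
move=> [s [sS <- <-]] [r [rS <- <-]]; exists (s ++ r).
rewrite size_cat big_cat; split=> // x.
by rewrite mem_cat => /orP[/sS|/rS].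
Qed.

Lemma is_word1 S : is_word_for S 1 0.
Proof. by exists [::]; split=> //; rewrite big_nil. Qed.

Lemma is_word_letter S x : x \in letters S -> is_word_for S x 1.
Proof.
move=> xS; exists [:: x]; split; rewrite ?big_seq1 // => y.
by rewrite inE => /eqP ->.
Qed.

End WordLength.

Section Wreath.
Variable G : groupType.

(* An element of G wr Z is a pair (f, n), with f in the direct sum of copies of
   G indexed by Z and n in Z. *)
Record wreath := Wreath { lamps : {fsfun int -> G with 1}; cursor : int }.

Definition wreath_to_pair (u : wreath) := (lamps u, cursor u).
Definition wreath_of_pair p := Wreath p.1 p.2.
Lemma wreath_to_pairK : cancel wreath_to_pair wreath_of_pair.
Proof. by case. Qed.
HB.instance Definition _ := Choice.copy wreath (can_type wreath_to_pairK).

Implicit Types u v : wreath.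

Lemma wreathP u v :
  (forall i, lamps u i = lamps v i) -> cursor u = cursor v -> u = v.
Proof. by case: u v => [f m] [g n] /= /fsfunP -> ->. Qed.

Definition wreath_one := Wreath [fsfun with 1] 0%R.

(* The finite sets over which the functions below are defined contain the
   supports of the pointwise expressions; see wreath_mulE and wreath_invE. *)
Definition wreath_mul u v := Wreath
  [fsfun i in finsupp (lamps u) `|` [fset (i + cursor u)%R | i in finsupp (lamps v)]
     => lamps u i * lamps v (i - cursor u)%R]
  (cursor u + cursor v)%R.

Definition wreath_inv u := Wreath
  [fsfun i in [fset (i - cursor u)%R | i in finsupp (lamps u)]
     => (lamps u (i + cursor u)%R)^-1]
  (- cursor u)%R.

Lemma wreath_mulE u v i :
  lamps (wreath_mul u v) i = lamps u i * lamps v (i - cursor u)%R.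
Proof.
rewrite fsfunE inE; case: ifPn => //; rewrite negb_or => /andP[ui vi].
rewrite (fsfun_dflt ui) fsfun_dflt ?mulg1 //.
by apply: contra vi => vi; apply/imfsetP; exists (i - cursor u)%R; rewrite ?GRing.subrK.
Qed.

Lemma wreath_invE u i :
  lamps (wreath_inv u) i = (lamps u (i + cursor u)%R)^-1.
Proof.
rewrite fsfunE; case: ifPn => // ui; rewrite fsfun_dflt ?invg1 //.
by apply: contra ui => ui; apply/imfsetP; exists (i + cursor u)%R; rewrite ?GRing.addrK.
Qed.

Lemma wreath_mulA : associative wreath_mul.
Proof.
move=> u v w; apply: wreathP => [i|]; last by rewrite /= GRing.addrA.
by rewrite !wreath_mulE /= mulgA GRing.opprD GRing.addrA.
Qed.

Lemma wreath_mul1 : left_id wreath_one wreath_mul.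
Proof.
move=> u; apply: wreathP => [i|]; last by rewrite /= GRing.add0r.
by rewrite wreath_mulE fsfunE GRing.subr0 mul1g.
Qed.

Lemma wreath_mulr1 : right_id wreath_one wreath_mul.
Proof.
move=> u; apply: wreathP => [i|]; last by rewrite /= GRing.addr0.
by rewrite wreath_mulE fsfunE mulg1.
Qed.

Lemma wreath_mulV : left_inverse wreath_one wreath_inv wreath_mul.
Proof.
move=> u; apply: wreathP => [i|]; last by rewrite /= GRing.addNr.
by rewrite wreath_mulE wreath_invE /= GRing.opprK mulVg fsfunE.
Qed.

Lemma wreath_mulrV : right_inverse wreath_one wreath_inv wreath_mul.
Proof.
move=> u; apply: wreathP => [i|]; last by rewrite /= GRing.subrr.
by rewrite wreath_mulE wreath_invE GRing.subrK mulgV fsfunE.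
Qed.

HB.instance Definition _ := isGroup.Build wreath
  wreath_mulA wreath_mul1 wreath_mulr1 wreath_mulV wreath_mulrV.

Definition shift n : wreath := Wreath [fsfun with 1] n.

Definition wreath_t : wreath := shift 1%R.

Definition base_copy i g : wreath := Wreath [fsfun [fsfun with 1] with i |-> g] 0%R.

Definition lamp : G -> wreath := base_copy 0%R.

Lemma lampsM u v i : lamps (u * v) i = lamps u i * lamps v (i - cursor u)%R.
Proof. exact: wreath_mulE. Qed.

Lemma cursorM u v : cursor (u * v) = (cursor u + cursor v)%R.
Proof. by []. Qed.

Lemma lamps_base_copy i g j : lamps (base_copy i g) j = if j == i then g else 1.
Proof. by rewrite fsfun_withE fsfunE. Qed.

Lemma lamps_shift n i : lamps (shift n) i = 1.
Proof. by rewrite fsfunE. Qed.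

Lemma base_copyM i g h : base_copy i (g * h) = base_copy i g * base_copy i h.
Proof.
apply: wreathP => // j; rewrite lampsM !lamps_base_copy GRing.subr0.
by case: ifP; rewrite ?mulg1.
Qed.

Lemma base_copy1 i : base_copy i 1 = 1.
Proof. by apply: wreathP => //= j; rewrite lamps_base_copy fsfunE if_same. Qed.

Lemma base_copyV i g : base_copy i g^-1 = (base_copy i g)^-1.
Proof. by apply: (@mulgI _ (base_copy i g)); rewrite -base_copyM !mulgV base_copy1. Qed.

Lemma shiftD m n : shift (m + n)%R = shift m * shift n.
Proof. by apply: wreathP => // i; rewrite lampsM !lamps_shift mulg1. Qed.

Lemma shift0 : shift 0%R = 1.
Proof. by []. Qed.

Lemma shiftN n : shift (- n)%R = (shift n)^-1.
Proof. by apply: (@mulgI _ (shift n)); rewrite -shiftD mulgV GRing.subrr. Qed.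

Lemma shift_nat n : shift n%:Z = wreath_t ^+ n.
Proof. by elim: n => [|n IHn]; rewrite ?shift0 // expgS -IHn -shiftD. Qed.

Lemma base_copyE i g : base_copy i g = shift i * lamp g * (shift i)^-1.
Proof.
apply: wreathP => [j|]; last by rewrite -shiftN !cursorM /= GRing.addr0 GRing.subrr.
rewrite -shiftN !lampsM !lamps_shift !lamps_base_copy mul1g mulg1 /=.
by rewrite GRing.subr_eq0.
Qed.

Definition wreath_gens (X : {fset G}) : {fset wreath} :=
  [fset lamp x | x in X] `|` [fset wreath_t].

Lemma lamp_letters X x : x \in letters X -> lamp x \in letters (wreath_gens X).
Proof.
rewrite !inE => /orP[xX|/imfsetP[y /= yX ->]].
  by apply/orP; left; apply/orP; left; apply: in_imfset.
apply/orP; right; apply/imfsetP; exists (lamp y); last exact: base_copyV.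
by rewrite /= !inE; apply/orP; left; apply: in_imfset.
Qed.

Lemma wreath_generates X : generates X -> generates (wreath_gens X).
Proof.
move=> genX; pose gen u := exists n, is_word_for (wreath_gens X) u n.
have genM u v : gen u -> gen v -> gen (u * v).
  by move=> [m um] [n vn]; exists (m + n)%N; apply: is_wordM.
have gen1 : gen 1 by exists 0; apply: is_word1.
have genl x : x \in letters (wreath_gens X) -> gen x.
  by move=> xX; exists 1%N; apply: is_word_letter.
have tX : wreath_t \in wreath_gens X by rewrite !inE eqxx orbT.
have genpow u n : gen u -> gen (u ^+ n).
  by move=> gu; elim: n => [|n IHn] //; rewrite expgS; apply: genM.
have gent n : gen (shift n).
  have gnat k : gen (shift k%:Z).
    by rewrite shift_nat; apply/genpow/genl; rewrite !inE in tX *; rewrite tX.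
  case: n => n //; rewrite NegzE shiftN shift_nat -expVgn; apply/genpow/genl.
  by rewrite inE; apply/orP; right; apply/imfsetP; exists wreath_t.
have genlamp g : gen (lamp g).
  have [_ [s [sX _ <-]]] := genX g; elim: s sX => [|x s IHs] sX.
    by rewrite big_nil /lamp base_copy1.
  rewrite big_cons /lamp base_copyM; apply: genM; last first.
    by apply: IHs => y ys; apply: sX; rewrite inE ys orbT.
  by apply/genl/lamp_letters/sX; rewrite inE eqxx.
have gencopy i g : gen (base_copy i g).
  by rewrite base_copyE -shiftN; apply: (genM _ _ _ (gent _)); exact: (genM _ _ (gent _) (genlamp _)).
have genf (f : {fsfun int -> G with 1}) : gen (Wreath f 0%R).
  have [n] := ubnP #|` finsupp f|; elim: n f => // n IHn f fn.
  have [f0|[i fi]] := fset_0Vmem (finsupp f).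
    suff -> : Wreath f 0%R = 1 by [].
    apply: wreathP => //= i; rewrite [RHS]fsfunE fsfun_dflt //.
    by rewrite f0 in_fset0.
  pose f' : {fsfun int -> G with 1} := [fsfun f without i].
  suff -> : Wreath f 0%R = base_copy i (f i) * Wreath f' 0%R.
    apply: genM => //; apply: IHn.
    by rewrite finsupp_without; move: fn; rewrite (cardfsD1 i) fi.
  apply: wreathP => // j; rewrite lampsM lamps_base_copy /= GRing.subr0.
  rewrite /f' /app_fswithout fsfunE !inE mem_finsupp /=.
  have [->|_] := eqVneq j i; first by rewrite /= mulg1.
  by rewrite mul1g /=; case: eqP.
case=> f n; suff -> : Wreath f n = Wreath f 0%R * shift n by apply: genM.
apply: wreathP => [i|]; last by rewrite /= GRing.add0r.
by rewrite lampsM lamps_shift mulg1.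
Qed.

End Wreath.

(* Main.v *)
Require Import Defs.
From mathcomp Require Import all_boot finmap.
From mathcomp Require Import all_order all_algebra zify.

(** An element of the wreath product is a configuration of lamps on the integers
    together with a cursor. A word in the generators is a tour of the cursor
    that edits the lamps it stands on, so its length is the number of moves plus
    the number of edits. Let w be a dead end of depth d in G, of length L. The
    dead end of the wreath product is v = plateau d w: every lamp at distance at
    most d from the origin is set to w, all others are off, and the cursor is at
    the origin.

    The tour that builds v must reach both d and - d and come back, which takes
    4d moves, so v has length 4d + (2d + 1)L: tour_lower_bound and
    tour_upper_bound. This is the largest length possible for a configuration
    supported on [- d, d], with lamps of length at most L and the cursor in
    [- d, d], because a tour that may stop off the origin is never longer.
    Multiplying v by at most d generators stays among such configurations: the
    cursor cannot leave [- d, d] (word_reach), and each lamp receives at most d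
    letters, so its length stays at most L because w has depth d. Hence v has
    depth at least d.

    Conversely, letters of G multiplied to v act on the lamp at the origin,
    where v carries w. As d > 0, the lamps at d and - d are not affected, they
    are non-trivial (dead_end_neq1), and the number of moves cannot drop below
    4d. So a product s that makes w s longer than w makes v s longer than v, and
    the depth of v is at most that of w. *)

Set Implicit Arguments.
Unset Strict Implicit.
Unset Printing Implicit Defensive.

Import GRing.Theory.
Local Open Scope group_scope.
Local Open Scope fset_scope.

(** * Word length *)

Section WordLengthTheory.
Variables (H : groupType) (S : {fset H}) (genS : generates S).
Implicit Types (v w : H) (n : nat).

Lemma wlen_word w : is_word_for S w (wlen genS w).
Proof. by rewrite /wlen; case: ex_minnP => n /boolp.asboolP. Qed.

Lemma wlen_min w n : is_word_for S w n -> (wlen genS w <= n)%N.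
Proof.
by move=> wn; rewrite /wlen; case: ex_minnP => m _; apply; apply/boolp.asboolP.
Qed.

Lemma wlen1 : wlen genS 1 = 0%N.
Proof. by apply/eqP; rewrite -leqn0; apply/wlen_min/is_word1. Qed.

Lemma wlen_eq0 w : wlen genS w = 0%N -> w = 1.
Proof.
by have [s [_ <- <-]] := wlen_word w => /size0nil ->; rewrite big_nil.
Qed.

Lemma wlenM v w : (wlen genS (v * w) <= wlen genS v + wlen genS w)%N.
Proof. by apply/wlen_min/is_wordM; apply: wlen_word. Qed.

Lemma wlen_letter x : x \in letters S -> (wlen genS x <= 1)%N.
Proof. by move=> xS; apply/wlen_min/is_word_letter. Qed.

Lemma stays_within_word w k n v :
  stays_within genS w k -> is_word_for S v n -> (n <= k)%N ->
  (wlen genS (w * v) <= wlen genS w)%N.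
Proof.
move=> wk [[|x s] [sS <- <-]] nk; first by rewrite big_nil mulg1.
by apply: wk.
Qed.

Lemma stays_within_dead_end w k :
  (0 < k)%N -> stays_within genS w k -> dead_end genS w.
Proof.
by move=> k_gt0 wk x xS; apply: (stays_within_word wk (is_word_letter xS)).
Qed.

(** If 1 is a dead end then every generator has length 0, so the group is
    trivial. *)
Lemma dead_end_neq1 w :
  (exists g : H, g <> 1) -> dead_end genS w -> w != 1.
Proof.
move=> [g gn1] wd; apply/eqP => w1; apply: gn1.
have [_ [s [sS _ <-]]] := genS g; rewrite big1_seq // => x /andP[_ /sS xS].
by apply: wlen_eq0; apply/eqP; have := wd x xS; rewrite w1 mul1g wlen1 leqn0.
Qed.

End WordLengthTheory.

(** * Tours of the cursor *)

Section WreathWords.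
Variables (G : groupType) (X : {fset G}).
Implicit Types (u : wreath G) (i : int).

Lemma lampsMlamp u g i :
  lamps (u * lamp g) i = lamps u i * (if i == cursor u then g else 1).
Proof. by rewrite lampsM lamps_base_copy subr_eq0. Qed.

Lemma cursorMlamp u g : cursor (u * lamp g) = cursor u.
Proof. by rewrite cursorM addr0. Qed.

Lemma lampsMshift u n i : lamps (u * shift G n) i = lamps u i.
Proof. by rewrite lampsM lamps_shift mulg1. Qed.

Lemma cursorMshift u n : cursor (u * shift G n) = (cursor u + n)%R.
Proof. by []. Qed.

Lemma lamp_prod (s : seq G) : lamp (\prod_(x <- s) x) = \prod_(x <- s) lamp x.
Proof.
apply: (big_morph (@lamp G)) => [x y|]; first exact: base_copyM.
exact: base_copy1.
Qed.

Lemma wreath_letter u : u \in letters (wreath_gens X) ->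
  (exists2 x, x \in letters X & u = lamp x)
  \/ (exists2 e, (e == 1%R) || (e == (-1)%R) & u = shift G e).
Proof.
have gensP v : v \in wreath_gens X ->
    (exists2 x, x \in X & v = lamp x) \/ v = shift G 1.
  rewrite !inE => /orP[/imfsetP[x /= xX ->]|/eqP ->]; last by right.
  by left; exists x.
rewrite inE.
case/orP => [/gensP[[x xX ->]| ->]|/imfsetP[v /= /gensP[[x xX ->]| ->] ->]].
- by left; exists x; rewrite // !inE xX.
- by right; exists 1%R.
- left; exists x^-1; last by rewrite -base_copyV.
  by rewrite !inE; apply/orP; right; apply/imfsetP; exists x.
- by right; exists (-1)%R; rewrite // shiftN.
Qed.

Lemma shift_letter (e : int) :
  (e == 1%R) || (e == (-1)%R) -> shift G e \in letters (wreath_gens X).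
Proof.
case/orP => /eqP ->; first by rewrite !inE eqxx orbT.
rewrite inE; apply/orP; right; apply/imfsetP; exists (wreath_t G).
  by rewrite /= !inE eqxx orbT.
by rewrite -shiftN.
Qed.

(** The counters p and q record the moves of the cursor and the edits of the
    lamps: lower bounds on the length come from invariants that bound the two
    kinds of letters separately. *)
Lemma wreath_word_ind (P : wreath G -> nat -> nat -> Prop) :
  P 1 0 0 ->
  (forall u p q x, x \in letters X -> P u p q -> P (u * lamp x) p q.+1) ->
  (forall u p q e, (e == 1%R) || (e == (-1)%R) ->
     P u p q -> P (u * shift G e) p.+1 q) ->
  forall u n, is_word_for (wreath_gens X) u n ->
  exists p q, n = (p + q)%N /\ P u p q.
Proof.
move=> P1 Plamp Pshift u n [s [sS <- <-]]; elim/last_ind: s sS => [|s x IHs] sS.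
  by exists 0%N, 0%N; rewrite big_nil.
have [|p [q [spq Ppq]]] := IHs.
  by move=> y ys; apply: sS; rewrite mem_rcons inE ys orbT.
have /wreath_letter : x \in letters (wreath_gens X).
  by apply: sS; rewrite mem_rcons mem_head.
rewrite big_rcons size_rcons spq => -[[y yX ->]|[e e1 ->]].
  by exists p, q.+1; rewrite addnS; split=> //; apply: Plamp.
by exists p.+1, q; rewrite addSn; split=> //; apply: Pshift.
Qed.

(** Only the lamps visited by the cursor are edited, and all edits of one lamp
    spell a word of G inside the given word. *)
Lemma word_reach u n : is_word_for (wreath_gens X) u n ->
  [/\ (`|cursor u| <= n)%N,
      forall i, exists2 k, (k <= n)%N & is_word_for X (lamps u i) k
    & forall i, (n < `|i|)%N -> lamps u i = 1].
Proof.
pose P u p q := [/\ (`|cursor u| <= p)%N,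
  forall i, exists2 k, (k <= q)%N & is_word_for X (lamps u i) k
  & forall i, (p < `|i|)%N -> lamps u i = 1].
move=> un; have [||||p [q [-> [cu ku u1]]]] := @wreath_word_ind P _ _ _ u n.
- split=> // i; last by rewrite fsfunE.
  by exists 0%N => //; rewrite fsfunE; apply: is_word1.
- move=> {un}u p q x xX [cu ku u1]; split=> [|i|i pi].
  + by rewrite cursorMlamp.
  + have [k kq uk] := ku i; rewrite lampsMlamp; case: eqP => _.
      by exists (k + 1)%N; [lia|apply: is_wordM uk (is_word_letter xX)].
    by exists k; [lia|rewrite mulg1].
  + rewrite lampsMlamp u1 // ifN ?mulg1 //; lia.
- move=> {un}u p q e e1 [cu ku u1]; split=> [|i|i pi].
  + by rewrite cursorM /=; lia.
  + by rewrite lampsMshift; apply: ku.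
  + by rewrite lampsMshift u1 //; lia.
- by [].
split=> [|i|i ni]; [lia| |apply: u1; lia].
by have [k kq uk] := ku i; exists k => //; lia.
Qed.

Hypothesis genX : generates X.
Notation wlenG := (wlen genX).
Notation wlenW := (wlen (wreath_generates genX)).

(** A tour that lights the lamps at both m and - m visits both points, and one
    of them first; from there it crosses to the other and then returns to the
    origin, for m + 2m + m moves. Each edit increases the total length of the
    lamps by at most one. *)
Lemma tour_lower_bound u (m : nat) (r : seq int) : uniq r ->
  cursor u = 0%R -> lamps u m != 1 -> lamps u (- m%:Z)%R != 1 ->
  (4 * m + \sum_(i <- r) wlenG (lamps u i) <= wlenW u)%N.
Proof.
move=> Ur cu0 um uNm.
(* The bounds for one and for two lit endpoints are what makes the invariant
   inductive: when the second endpoint is lit, the bound for the first gives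
   the m + 2m moves made so far. *)
pose P u p q := [/\ (`|cursor u| <= p)%N,
  lamps u m != 1 -> (m + `|(cursor u - m%:Z)%R| <= p)%N,
  lamps u (- m%:Z)%R != 1 -> (m + `|(cursor u + m%:Z)%R| <= p)%N,
  lamps u m != 1 -> lamps u (- m%:Z)%R != 1 ->
    (3 * m + minn `|(cursor u - m%:Z)%R| `|(cursor u + m%:Z)%R| <= p)%N
  & (\sum_(i <- r) wlenG (lamps u i) <= q)%N].
have uW := wlen_word (wreath_generates genX) u.
have [|||p [q [-> [_ _ _ /(_ um uNm)]]]] := @wreath_word_ind P _ _ _ u _ uW.
- split; rewrite ?fsfunE ?eqxx //.
  by rewrite big1 // => i _; rewrite fsfunE wlen1.
- move=> {um uNm cu0 uW}u p q x xX [cp up uNp upp sq].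
  have lamp_off i : i != cursor u -> lamps (u * lamp x) i = lamps u i.
    by move=> /negPf ic; rewrite lampsMlamp ic mulg1.
  split; rewrite ?cursorMlamp //.
  + have [mc _|/lamp_off ->] := eqVneq (m : int) (cursor u); [lia|exact: up].
  + have [mc _|/lamp_off ->] := eqVneq (- m%:Z)%R (cursor u); [lia|exact: uNp].
  + have [mc|/lamp_off ->] := eqVneq (m : int) (cursor u);
      have [mc'|/lamp_off ->] := eqVneq (- m%:Z)%R (cursor u).
    * lia.
    * move=> _ /uNp; lia.
    * move=> /up + _; lia.
    * exact: upp.
  + have [cr|cr] := boolP (cursor u \in r); last first.
      rewrite (leq_trans _ (leqW sq)) // leq_eqVlt; apply/orP; left; apply/eqP.
      apply: eq_big_seq => i ir; rewrite lamp_off //.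
      by apply: contraNneq cr => <-.
    have rest : (\sum_(i <- r | i != cursor u) wlenG (lamps (u * lamp x)%g i)
                 = \sum_(i <- r | i != cursor u) wlenG (lamps u i))%N.
      by apply: eq_bigr => i ic; rewrite lamp_off.
    move: sq; rewrite !(bigD1_seq (cursor u)) // rest lampsMlamp eqxx => sq.
    apply: leq_trans (leq_add (wlenM _ _ _) (leqnn _)) _.
    by rewrite addnAC -addn1 leq_add ?wlen_letter.
- move=> {um uNm cu0 uW}u p q e e1 [cp up uNp upp sq].
  split; rewrite ?lampsMshift ?cursorMshift.
  + lia.
  + by move=> /up; lia.
  + by move=> /uNp; lia.
  + by move=> um uNm; have := upp um uNm; lia.
  + rewrite (eq_bigr (fun i => wlenG (lamps u i))) // => i _.
    by rewrite lampsMshift.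
rewrite cu0; lia.
Qed.

Lemma wlen_shift (n : int) : (wlenW (shift G n) <= `|n|)%N.
Proof.
have wlen_nat e k : (e == 1%R) || (e == (-1)%R) ->
    (wlenW (shift G (e * k%:Z)%R) <= k)%N.
  move=> e1; elim: k => [|k IHk]; first by rewrite mulr0 shift0 wlen1.
  rewrite intS mulrDr mulr1 shiftD; apply: leq_trans (wlenM _ _ _) _.
  rewrite -add1n leq_add //.
  by apply/wlen_letter/shift_letter.
have [n0|n0] := boolP (0 <= n)%R.
  by rewrite -[X in shift G X](gez0_abs n0) -[X in shift G X]mul1r wlen_nat.
have -> : n = (-1 * (`|n|%N)%:Z)%R by lia.
by rewrite (leq_trans (wlen_nat _ _ _)) //; lia.
Qed.

Lemma wlen_lamp g : (wlenW (lamp g) <= wlenG g)%N.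
Proof.
have [s [sX <- {1}<-]] := wlen_word genX g; apply: wlen_min.
exists (map (@lamp G) s); rewrite size_map big_map lamp_prod; split=> //.
by move=> _ /mapP[x /sX xX ->]; apply: lamp_letters.
Qed.

(** The tour goes straight to a, then makes k steps in the direction e, setting
    each lamp to its final value in passing. *)
Lemma sweep_upper_bound (L : nat) (a e : int) (k : nat) u :
  (e == 1%R) || (e == (-1)%R) -> cursor u = (a + e * k%:Z)%R ->
  (forall i, wlenG (lamps u i) <= L)%N ->
  (forall i, lamps u i != 1 -> exists2 j, (j <= k)%N & i = (a + e * j%:Z)%R) ->
  (wlenW u <= `|a| + k + k.+1 * L)%N.
Proof.
move=> e1; elim: k u => [|k IHk] u cu uL u1.
  have -> : u = shift G a * lamp (lamps u a).
    apply: wreathP => [i|]; last by rewrite cursorMlamp cu mulr0 addr0.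
    rewrite lampsMlamp lamps_shift mul1g; case: eqP => [->//|/eqP ia].
    apply/eqP; apply: contraNT ia => /u1[j]; rewrite leqn0 => /eqP -> ->.
    by rewrite mulr0 addr0.
  apply: leq_trans (wlenM _ _ _) _.
  rewrite addn0 mul1n leq_add ?wlen_shift //.
  exact: leq_trans (wlen_lamp _) _.
set b := cursor u; set g := lamps u b.
(* v is u before the last step and the last edit of the sweep. *)
pose v := u * lamp g^-1 * shift G (- e)%R.
have lv i : lamps v i = if i == b then 1 else lamps u i.
  rewrite lampsMshift lampsMlamp; case: eqP => [->|_]; first by rewrite mulgV.
  by rewrite mulg1.
have -> : u = v * shift G e * lamp g.
  by rewrite /v shiftN mulgVK /lamp base_copyV mulgVK.
have vk : (wlenW v <= `|a| + k + k.+1 * L)%N.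
  apply: IHk => [|i|i].
  - by rewrite cursorM cursorMlamp cu /=; lia.
  - by rewrite lv; case: ifP => // _; rewrite wlen1.
  - rewrite lv; case: (eqVneq i b) => [_|ib ui]; first by rewrite eqxx.
    have [j jk ij] := u1 i ui; exists j => //.
    rewrite -ltnS ltn_neqAle jk andbT.
    by apply: contraNneq ib => jk1; rewrite ij jk1 /b cu.
have ve := leq_trans (wlenM (wreath_generates genX) v (shift G e))
  (leq_add vk (wlen_letter _ (shift_letter e1))).
apply: leq_trans (wlenM _ _ _) _.
apply: leq_trans (leq_add ve (leq_trans (wlen_lamp g) (uL b))) _.
lia.
Qed.

(** The sweep ends at the endpoint of [- m, m] on the side of the final cursor
    position, so that the way back from there takes at most m moves. *)
Lemma tour_upper_bound (L m : nat) u : (`|cursor u| <= m)%N ->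
  (forall i, wlenG (lamps u i) <= L)%N ->
  (forall i, (m < `|i|)%N -> lamps u i = 1) ->
  (wlenW u <= 4 * m + (2 * m).+1 * L)%N.
Proof.
move=> cu uL u1.
pose e : int := if (0 <= cursor u)%R then 1%R else (-1)%R.
have e1 : (e == 1%R) || (e == (-1)%R) by rewrite /e; case: ifP.
(* v is u at the end of the sweep, before the way back. *)
pose v := u * shift G (e * m%:Z - cursor u)%R.
have vm : (wlenW v <= `|(- e * m%:Z)%R| + 2 * m + (2 * m).+1 * L)%N.
  apply: (sweep_upper_bound e1) => [|i|i].
  - by rewrite cursorM /=; lia.
  - by rewrite lampsMshift.
  - rewrite lampsMshift => ui.
    have im : (`|i| <= m)%N by rewrite leqNgt; apply: contraNN ui => /u1/eqP.
    by exists `|(i + e * m%:Z)%R|%N; move: e1 => /orP[]/eqP ->; lia.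
have -> : u = v * shift G (cursor u - e * m%:Z)%R.
  by rewrite -mulgA -shiftD addrC subrKA subrr mulg1.
apply: leq_trans (wlenM _ _ _) _.
apply: leq_trans (leq_add vm (wlen_shift _)) _.
by rewrite /e; case: ifP; lia.
Qed.

End WreathWords.

(** * The dead end of the wreath product *)

Definition window (m : nat) : seq int :=
  [seq (j%:Z - m%:Z)%R | j <- iota 0 (2 * m).+1].

Definition plateau (G : groupType) (m : nat) (w : G) : wreath G :=
  Wreath [fsfun i in [fset i | i in window m] => w] 0%R.

Lemma mem_window m i : (i \in window m) = (`|i| <= m)%N.
Proof.
apply/mapP/idP => [[j + ->]|im]; first by rewrite mem_iota; lia.
by exists `|(i + m%:Z)%R|%N; rewrite ?mem_iota; lia.
Qed.

Lemma window_uniq m : uniq (window m).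
Proof. by rewrite map_inj_uniq ?iota_uniq // => j k; lia. Qed.

Lemma lamps_plateau (G : groupType) m (w : G) i :
  lamps (plateau m w) i = if (`|i| <= m)%N then w else 1.
Proof. by rewrite -mem_window fsfunE in_fset. Qed.

Theorem theorem6p1 (G : groupType) (hG : exists g : G, g <> 1%g)
  (X : {fset G}) (genX : generates X) (d : nat) (hd : (0 < d)%N)
  (hX : exists w : G, dead_end_of_depth genX w d) :
  exists w : wreath G, dead_end_of_depth (wreath_generates genX) w d.
Proof.
have [w [w_dead w_d w_max]] := hX.
have w_neq1 : w != 1 := dead_end_neq1 hG w_dead.
pose L := wlen genX w.
pose v := plateau d w.
have v_lower g : (4 * d + 2 * d * L + wlen genX (w * g)
                  <= wlen (wreath_generates genX) (v * lamp g))%N.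
  have lamp_off (i : int) : i != 0%R -> (`|i| <= d)%N ->
      lamps (v * lamp g) i = w.
    by move=> /negPf i0 id; rewrite lampsMlamp i0 mulg1 lamps_plateau id.
  have wd i : `|i|%N = d -> lamps (v * lamp g) i != 1.
    by move=> id; rewrite lamp_off //; lia.
  have d0 : 0%R \in window d by rewrite mem_window.
  have sumL : (\sum_(i <- window d | i != 0%R) L = 2 * d * L)%N.
    have : (\sum_(i <- window d) L = (2 * d).+1 * L)%N.
      by rewrite big_const_seq count_predT size_map size_iota iter_addn_0 mulnC.
    by rewrite (bigD1_seq 0%R d0 (window_uniq d)) /= mulSn => /addnI.
  have := tour_lower_bound genX (window_uniq d) (cursorMlamp v g : _ = 0%R)
    (wd d%:Z%R erefl) (wd (- d%:Z)%R (abszN _)).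
  apply: leq_trans; rewrite (bigD1_seq 0%R d0 (window_uniq d)).
  rewrite lampsMlamp eqxx lamps_plateau leq0n -addnA leq_add2l addnC leq_add2l.
  rewrite -sumL [leqLHS]big_seq_cond [leqRHS]big_seq_cond.
  apply: leq_sum => i /andP[].
  by rewrite mem_window => id /lamp_off ->.
have v_upper g k : is_word_for (wreath_gens X) g k -> (k <= d)%N ->
    (wlen (wreath_generates genX) (v * g) <= 4 * d + (2 * d).+1 * L)%N.
  move=> /word_reach[cg lg g1] kd.
  have lvg i : lamps (v * g) i = lamps v i * lamps g i by rewrite lampsM subr0.
  apply: tour_upper_bound => [|i|i di].
  - by rewrite cursorM add0r (leq_trans cg).
  - rewrite lvg lamps_plateau; case: (leqP `|i| d) => [_|di].
      have [l lk gl] := lg i.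
      exact: (stays_within_word w_d gl (leq_trans lk kd)).
    by rewrite g1 ?mulg1 ?wlen1 //; lia.
  - by rewrite lvg lamps_plateau leqNgt di /= mul1g g1 //; lia.
have v_len : wlen (wreath_generates genX) v = (4 * d + (2 * d).+1 * L)%N.
  apply/eqP; rewrite eqn_leq.
  have := v_upper 1 0%N (is_word1 _) isT; rewrite mulg1 => -> /=.
  have := v_lower 1; rewrite /lamp base_copy1 !mulg1 -/L; lia.
have v_d : stays_within (wreath_generates genX) v d.
  move=> s sX /andP[_ sd]; rewrite [leqRHS]v_len.
  by apply: (v_upper _ (size s)) => //; exists s.
exists v; split=> //; first exact: stays_within_dead_end v_d.
move=> k vk; apply: w_max => s sX sk.
have := vk (map (@lamp G) s); rewrite size_map big_map -lamp_prod v_len.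
have lampX : {subset map (@lamp G) s <= letters (wreath_gens X)}.
  by move=> _ /mapP[x /sX xX ->]; apply: lamp_letters.
move=> /(_ lampX sk) /(leq_trans (v_lower _)).
by rewrite (mulSn (2 * d)) [(L + _)%N]addnC addnA leq_add2l.
Qed.
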